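(* Let $\rho,A,E,I,\ell,I_1,I_2,I_3,\varkappa>0$, $\ell_0\ge 0$, $\omega_0\in\mathbb{R}$, and let $\nu_1,\nu_2,\nu_3>0$ be constant gains. Consider the abstract closed-loop system $\dot{\boldsymbol\xi}(t)=F\boldsymbol\xi(t)$ on the Hilbert space $X$ with the nonlinear operator $F:D(F)\to X$ described in the context, and assume (Assumption A1) that the Cauchy problem $\dot{\boldsymbol\xi}=F\boldsymbol\xi$, $\boldsymbol\xi(0)=\boldsymbol\xi_0$, is well-posed on $[0,+\infty)$. Then the equilibrium $$\hat{\boldsymbol\xi}=(0,0,\;0,0,\;-\omega_0,0,0,\;0,0,0,1)^T\in X$$ is stable with respect to the functional $$y(\boldsymbol\xi)=\|w_1\|_{H^2(0,\ell)}+\|w_2\|_{H^2(0,\ell)}+\|v_1\|_{L^2(0,\ell)}+\|v_2\|_{L^2(0,\ell)},$$ that is: for every $\varepsilon>0$ there exists $\delta(\varepsilon)>0$ such that every solution $\boldsymbol\xi(\cdot)$ of $\dot{\boldsymbol\xi}=F\boldsymbol\xi$ on $[0,\infty)$ with $\|\boldsymbol\xi(0)-\hat{\boldsymbol\xi}\|_X<\delta(\varepsilon)$ satisfies $y(\boldsymbol\xi(t))<\varepsilon$ for all $t\ge0$.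
   Context: State space: $X$ is the real Hilbert space of tuples $\boldsymbol\xi=(w_1,v_1,w_2,v_2,\omega_1,\omega_2,\omega_3,q_1,q_2,q_3,q_4)^T$ with $w_1,w_2\in H^2(0,\ell)$, $v_1,v_2\in L^2(0,\ell)$, $\omega_i,q_j\in\mathbb{R}$, and $w_1(0)=w_2(0)=0$, $w_1'(0)=w_2'(0)=0$ (prime = derivative in $\zeta\in[0,\ell]$), with inner product $$\langle\boldsymbol\xi,\bar{\boldsymbol\xi}\rangle_X=\int_0^\ell\Big(\rho A(v_1\bar v_1+v_2\bar v_2)+EI(w_1''\bar w_1''+w_2''\bar w_2'')\Big)d\zeta+\sum_{i=1}^3 I_i\omega_i\bar\omega_i+\varkappa\sum_{j=1}^4 q_j\bar q_j.$$ Functionals: $\gamma_1(v_2)=\int_0^\ell(\zeta+\ell_0)v_2\,d\zeta$, $\gamma_2(v_1)=-\int_0^\ell(\zeta+\ell_0)v_1\,d\zeta$, $\gamma_3(w_1,w_2,v_1,v_2)=\int_0^\ell(w_2v_1-w_1v_2)\,d\zeta$. Domain: $D(F)=\{\boldsymbol\xi\in X: w_j\in H^4(0,\ell),\ w_j(0)=w_j'(0)=0,\ w_j''(\ell)=w_j'''(\ell)=0,\ v_j\in H^2(0,\ell),\ v_j(0)=v_j'(0)=0,\ j=1,2\}$. Operator: $F\boldsymbol\xi$ has components, in order, $v_1$; $-\frac{EI}{\rho A}w_1^{(4)}+2\omega_3v_2+\nu_2(\zeta+\ell_0)\gamma_2(v_1)-\nu_3w_2\gamma_3$; $v_2$; $-\frac{EI}{\rho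 A}w_2^{(4)}-2\omega_3v_1-\nu_1(\zeta+\ell_0)\gamma_1(v_2)+\nu_3w_1\gamma_3$; $\omega_2\omega_3-\nu_1\gamma_1(v_2)$; $-\omega_1\omega_3-\nu_2\gamma_2(v_1)$; $-\nu_3\gamma_3$; $\tfrac12(\omega_3q_2-\omega_2q_3+(\omega_1+\omega_0)q_4)$; $\tfrac12((\omega_1-\omega_0)q_3-\omega_3q_1+\omega_2q_4)$; $\tfrac12(\omega_2q_1-(\omega_1-\omega_0)q_2+\omega_3q_4)$; $-\tfrac12(q_1(\omega_1+\omega_0)+q_2\omega_2+q_3\omega_3)$, where $\gamma_3=\gamma_3(w_1,w_2,v_1,v_2)$ and $w^{(4)}$ is the fourth $\zeta$-derivative. A solution on $[0,\infty)$ means a continuously differentiable map $\boldsymbol\xi:[0,\infty)\to X$ with $\boldsymbol\xi(t)\in D(F)$ and $\dot{\boldsymbol\xi}(t)=F\boldsymbol\xi(t)$ for all $t\ge0$; well-posedness (Assumption A1) means that for each initial datum $\boldsymbol\xi_0$ the Cauchy problem has a unique such solution defined on all of $[0,\infty)$. (This system models a satellite with rigid carrier of principal moments $I_1,I_2,I_3$, orbital rate $\omega_0$, and an Euler–Bernoulli cantilever boom of length $\ell$ attached at distance $\ell_0$, under the feedback control of the paper.) *)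

(* Defs.v *)
From HB Require Import structures.
From mathcomp Require Import all_boot all_order all_algebra.
From mathcomp Require Import all_classical all_reals all_analysis.
Set Implicit Arguments. Unset Strict Implicit. Unset Printing Implicit Defensive.
Import Order.TTheory GRing.Theory Num.Theory.
Import numFieldNormedType.Exports.
Local Open Scope classical_set_scope.
Local Open Scope ring_scope.

Definition itv (R : realType) (a b : R) : set R := `[a, b].

Definition L2 (R : realType) (l : R) (f : R -> R) : Prop :=
  measurable_fun `[0, l] f /\
  (\int[@lebesgue_measure R]_(x in itv 0 l) ((f x) ^+ 2)%:E < +oo)%E.

Definition rint (R : realType) (a b : R) (f : R -> R) : R :=
  fine (\int[@lebesgue_measure R]_(x in itv a b) (f x)%:E)%E.

(* g is the derivative of f in the absolutely continuous sense on [0,l]: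
   g is integrable and f(z) = f(0) + int_0^z g for every z in [0,l] *)
Definition wderiv (R : realType) (l : R) (f g : R -> R) : Prop :=
  (@lebesgue_measure R).-integrable `[0, l] (EFin \o g) /\
  forall z, 0 <= z <= l -> f z = f 0 + rint 0 z g.

(* d 0, d 1, ..., d k is a chain of successive (weak) derivatives, with
   d k in L^2; then d 0 is the continuous representative of an H^k(0,l) function
   whose j-th derivative is d j *)
Definition Hk_chain (R : realType) (l : R) (k : nat) (d : nat -> R -> R) : Prop :=
  (forall i, (i < k)%N -> wderiv l (d i) (d i.+1)) /\ L2 l (d k).

Definition ae_eq_on (R : realType) (l : R) (f g : R -> R) : Prop :=
  {ae @lebesgue_measure R, forall x, itv 0 l x -> f x = g x}.

Definition Hk_with (R : realType) (l : R) (k : nat) (w : R -> R) (d : nat -> R -> R) : Prop :=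
  Hk_chain l k d /\ ae_eq_on l w (d 0%N).

Definition inH (R : realType) (l : R) (k : nat) (w : R -> R) : Prop :=
  exists d, Hk_with l k w d.

(* the j-th derivative of w in H^k(0,l) (chosen representative; 0 if w is not in H^k) *)
Definition der (R : realType) (l : R) (k : nat) (w : R -> R) (j : nat) : R -> R :=
  match pselect (exists d, Hk_with l k w d) with
  | left H => proj1_sig (cid H) j
  | right _ => fun _ => 0
  end.

Definition L2norm2 (R : realType) (l : R) (f : R -> R) : R :=
  fine (\int[@lebesgue_measure R]_(x in itv 0 l) ((f x) ^+ 2)%:E)%E.

Definition L2norm (R : realType) (l : R) (f : R -> R) : R := Num.sqrt (L2norm2 l f).

Definition H2norm (R : realType) (l : R) (w : R -> R) : R :=
  Num.sqrt (L2norm2 l w + L2norm2 l (der l 2 w 1) + L2norm2 l (der l 2 w 2)).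

Record state (R : realType) := State {
  w1 : R -> R; v1 : R -> R; w2 : R -> R; v2 : R -> R;
  om1 : R; om2 : R; om3 : R;
  q1 : R; q2 : R; q3 : R; q4 : R }.

Definition st_add (R : realType) (a b : state R) : state R :=
  State (fun z => w1 a z + w1 b z) (fun z => v1 a z + v1 b z)
        (fun z => w2 a z + w2 b z) (fun z => v2 a z + v2 b z)
        (om1 a + om1 b) (om2 a + om2 b) (om3 a + om3 b)
        (q1 a + q1 b) (q2 a + q2 b) (q3 a + q3 b) (q4 a + q4 b).

Definition st_scale (R : realType) (c : R) (a : state R) : state R :=
  State (fun z => c * w1 a z) (fun z => c * v1 a z)
        (fun z => c * w2 a z) (fun z => c * v2 a z)
        (c * om1 a) (c * om2 a) (c * om3 a)
        (c * q1 a) (c * q2 a) (c * q3 a) (c * q4 a).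

Definition st_sub (R : realType) (a b : state R) : state R := st_add a (st_scale (-1) b).

Record params (R : realType) := Params {
  rho : R; Ar : R; E : R; I : R; ell : R;
  I1 : R; I2 : R; I3 : R; kappa : R; ell0 : R; omega0 : R;
  nu1 : R; nu2 : R; nu3 : R }.

Definition params_ok (R : realType) (p : params R) : Prop :=
  0 < rho p /\ 0 < Ar p /\ 0 < E p /\ 0 < I p /\ 0 < ell p /\
  0 < I1 p /\ 0 < I2 p /\ 0 < I3 p /\ 0 < kappa p /\ 0 <= ell0 p /\
  0 < nu1 p /\ 0 < nu2 p /\ 0 < nu3 p.

Definition inH2_clamped (R : realType) (l : R) (w : R -> R) : Prop :=
  exists d, Hk_with l 2 w d /\ d 0%N 0 = 0 /\ d 1%N 0 = 0.

Definition inX (R : realType) (p : params R) (x : state R) : Prop :=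
  inH2_clamped (ell p) (w1 x) /\ inH2_clamped (ell p) (w2 x) /\
  L2 (ell p) (v1 x) /\ L2 (ell p) (v2 x).

Definition Xnorm2 (R : realType) (p : params R) (x : state R) : R :=
  let l := ell p in
  rho p * Ar p * (L2norm2 l (v1 x) + L2norm2 l (v2 x))
  + E p * I p * (L2norm2 l (der l 2 (w1 x) 2) + L2norm2 l (der l 2 (w2 x) 2))
  + (I1 p * om1 x ^+ 2 + I2 p * om2 x ^+ 2 + I3 p * om3 x ^+ 2)
  + kappa p * (q1 x ^+ 2 + q2 x ^+ 2 + q3 x ^+ 2 + q4 x ^+ 2).

Definition Xnorm (R : realType) (p : params R) (x : state R) : R := Num.sqrt (Xnorm2 p x).

Definition inD (R : realType) (p : params R) (x : state R) : Prop :=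
  let l := ell p in
  inX p x /\
  (exists d, Hk_with l 4 (w1 x) d /\ d 0%N 0 = 0 /\ d 1%N 0 = 0 /\ d 2%N l = 0 /\ d 3%N l = 0) /\
  (exists d, Hk_with l 4 (w2 x) d /\ d 0%N 0 = 0 /\ d 1%N 0 = 0 /\ d 2%N l = 0 /\ d 3%N l = 0) /\
  (exists d, Hk_with l 2 (v1 x) d /\ d 0%N 0 = 0 /\ d 1%N 0 = 0) /\
  (exists d, Hk_with l 2 (v2 x) d /\ d 0%N 0 = 0 /\ d 1%N 0 = 0).

Definition gamma1 (R : realType) (p : params R) (x : state R) : R :=
  rint 0 (ell p) (fun z => (z + ell0 p) * v2 x z).
Definition gamma2 (R : realType) (p : params R) (x : state R) : R :=
  - rint 0 (ell p) (fun z => (z + ell0 p) * v1 x z).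
Definition gamma3 (R : realType) (p : params R) (x : state R) : R :=
  rint 0 (ell p) (fun z => w2 x z * v1 x z - w1 x z * v2 x z).

Definition Fop (R : realType) (p : params R) (x : state R) : state R :=
  let l := ell p in
  let c := E p * I p / (rho p * Ar p) in
  let g1 := gamma1 p x in let g2 := gamma2 p x in let g3 := gamma3 p x in
  State
    (v1 x)
    (fun z => - c * der l 4 (w1 x) 4 z + 2 * om3 x * v2 x z
              + nu2 p * (z + ell0 p) * g2 - nu3 p * w2 x z * g3)
    (v2 x)
    (fun z => - c * der l 4 (w2 x) 4 z - 2 * om3 x * v1 x z
              - nu1 p * (z + ell0 p) * g1 + nu3 p * w1 x z * g3)
    (om2 x * om3 x - nu1 p * g1)
    (- om1 x * om3 x - nu2 p * g2)
    (- nu3 p * g3)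
    ((om3 x * q2 x - om2 x * q3 x + (om1 x + omega0 p) * q4 x) / 2)
    (((om1 x - omega0 p) * q3 x - om3 x * q1 x + om2 x * q4 x) / 2)
    ((om2 x * q1 x - (om1 x - omega0 p) * q2 x + om3 x * q4 x) / 2)
    (- (q1 x * (om1 x + omega0 p) + q2 x * om2 x + q3 x * om3 x) / 2).

(* xi : [0,oo) -> X is continuously differentiable (one-sided at t = 0),
   xi(t) in D(F) and xi'(t) = F xi(t) for all t >= 0 *)
Definition is_solution (R : realType) (p : params R) (xi : R -> state R) : Prop :=
  (forall t, 0 <= t -> inD p (xi t)) /\
  (forall t, 0 <= t -> forall eps, 0 < eps -> exists2 dl, 0 < dl &
     forall h, h != 0 -> `|h| < dl -> 0 <= t + h ->
       Xnorm p (st_sub (st_scale h^-1 (st_sub (xi (t + h)) (xi t))) (Fop p (xi t))) < eps) /\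
  (forall t, 0 <= t -> forall eps, 0 < eps -> exists2 dl, 0 < dl &
     forall s, 0 <= s -> `|s - t| < dl ->
       Xnorm p (st_sub (Fop p (xi s)) (Fop p (xi t))) < eps).

(* Assumption A1: well-posedness on [0, +oo) (uniqueness as elements of X) *)
Definition wellposed (R : realType) (p : params R) : Prop :=
  forall x0, inD p x0 ->
    (exists xi, is_solution p xi /\ Xnorm p (st_sub (xi 0) x0) = 0) /\
    (forall xi xi', is_solution p xi -> is_solution p xi' ->
       Xnorm p (st_sub (xi 0) x0) = 0 -> Xnorm p (st_sub (xi' 0) x0) = 0 ->
       forall t, 0 <= t -> Xnorm p (st_sub (xi t) (xi' t)) = 0).

Definition xi_hat (R : realType) (p : params R) : state R :=
  State (fun _ => 0) (fun _ => 0) (fun _ => 0) (fun _ => 0)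
        (- omega0 p) 0 0 0 0 0 1.

Definition yfun (R : realType) (p : params R) (x : state R) : R :=
  let l := ell p in
  H2norm l (w1 x) + H2norm l (w2 x) + L2norm l (v1 x) + L2norm l (v2 x).

(* Main.v *)
(* The elastic energy
     W = rho A (|v1|^2 + |v2|^2) + E I (|w1''|^2 + |w2''|^2)
   is by itself a Lyapunov functional: along a solution the gyroscopic terms
   cancel, two integrations by parts with the clamped/free boundary conditions
   cancel the stiffness terms, and the control terms leave
     W' = - 2 rho A (nu1 gamma1^2 + nu2 gamma2^2 + nu3 gamma3^2) <= 0.
   Moreover W is bounded by the squared X-distance to the equilibrium, and by
   the Poincare inequality for clamped functions it controls y^2. *)
Require Import Defs.
From HB Require Import structures.
From mathcomp Require Import all_boot all_order all_algebra.
From mathcomp Require Import all_classical all_reals all_analysis.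
From mathcomp Require Import measurable_realfun ring lra.
Import Order.TTheory GRing.Theory Num.Theory.
Import numFieldNormedType.Exports.
Set Implicit Arguments. Unset Strict Implicit. Unset Printing Implicit Defensive.
Local Open Scope classical_set_scope.
Local Open Scope ring_scope.

(** The estimate closes on the elastic variables because [om3] is the only rotational variable in
    their equations, where it couples [v1] and [v2] skew-symmetrically, and because the elastic part
    of the equilibrium is zero. The obstacle is regularity. Positions agree only almost everywhere
    with Sobolev functions, and [der] picks a chain of derivatives by choice. All pairings must
    therefore ignore null sets without any measurability of the integrands, and chains must be
    unique up to null sets. A weak derivative is an integrable function with a given primitive, not
    a pointwise derivative, so integration by parts is obtained from Fubini on a triangle. In time,
    a solution is known only through difference quotients converging in the norm of X, one-sided at
    time 0. This convergence is split into its four L^2 parts, and each squared norm is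
    differentiated separately. It works for the curvatures since the position components of [Fop]
    are velocities, which lie in H^2 on the domain: the time derivative of w'' is v''. *)

(* the library's hint fails to unify with [lebesgue_measure], whose carrier is
   [measurableTypeR R] rather than [R] *)
#[local] Instance ae_lebesgue_filter (R : realType) :
  Filter (nbhs (almost_everywhere (@lebesgue_measure R))).
Proof. exact: (ae_filter_ringOfSetsType (@lebesgue_measure R)). Qed.

(** * Integrals under almost everywhere comparison *)

Section integral_ae.
Context d (T : measurableType d) (R : realType) (mu : {measure set T -> \bar R}).
Local Open Scope ereal_scope.
Import HBNNSimple.

(** Every nonnegative simple function below [f] is cut off on the exceptional null set. Its integral
    does not change, and the result lies below [g] everywhere. Only simple functions have to be
    measurable in this argument. *)
Lemma ge0_le_integral_ae (D : set T) (f g : T -> \bar R) :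
  (forall x, D x -> 0 <= f x) -> (forall x, D x -> 0 <= g x) ->
  {ae mu, forall x, D x -> f x <= g x} ->
  \int[mu]_(x in D) f x <= \int[mu]_(x in D) g x.
Proof.
move=> f0 g0 [N [mN N0 fgN]].
rewrite !ge0_integralE//; apply: ge_ereal_sup => _ [h /= hf <-].
have mC : measurable (~` N) by exact: measurableC.
have -> : sintegral mu h = sintegral mu (proj_nnsfun h mC).
  rewrite -!integralT_nnsfun; apply: ae_eq_integral => //;
    [exact/measurable_EFinP|exact/measurable_EFinP|].
  exists N; split => // x /= hx; apply: contrapT => xN; apply: hx => _.
  by rewrite mindicE mem_set// mulr1.
apply: ereal_sup_ubound; exists (proj_nnsfun h mC) => //= x.
rewrite mindicE; have [xN|xN] := pselect (N x).
  rewrite memNset; last by move=> /(_ xN).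
  rewrite mulr0 patchE; case: ifPn => // xD.
  by apply: g0; rewrite inE in xD.
rewrite mem_set// mulr1; apply: (le_trans (hf x)).
rewrite !patchE; case: ifPn => // /set_mem xD.
by apply: contrapT => fg; apply: xN; apply: fgN => /= /(_ xD).
Qed.

(* Unlike [ae_eq_integral], nothing is assumed measurable: elements of the state
   space are only almost everywhere equal to (Borel) measurable functions. *)
Lemma ae_eq_integralW (D : set T) (f g : T -> \bar R) :
  {ae mu, forall x, D x -> f x = g x} ->
  \int[mu]_(x in D) f x = \int[mu]_(x in D) g x.
Proof.
move=> fg; rewrite integralE [RHS]integralE.
by congr (_ - _); apply/eqP; rewrite eq_le; apply/andP; split;
  apply: ge0_le_integral_ae => // ; apply: filterS fg => x /[apply];
  rewrite !(funeposE,funenegE) => ->.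
Qed.

End integral_ae.

(** * Integrals over an interval and the L^2 pairing *)

Section L2.
Context (R : realType).
Notation mu := (@lebesgue_measure R).
Implicit Types (l c : R) (f g h : R -> R).

Lemma measurable_cc (a b : R) :
  measurable (itv a b : set (measurableTypeR R)).
Proof. exact: measurable_itv. Qed.

Lemma ae_eq_on_refl l f : ae_eq_on l f f.
Proof. exact/aeW. Qed.

Lemma ae_eq_on_sym l f g : ae_eq_on l f g -> ae_eq_on l g f.
Proof. by apply: filterS => x /[apply]. Qed.

Lemma ae_eq_on_trans l f g h :
  ae_eq_on l f g -> ae_eq_on l g h -> ae_eq_on l f h.
Proof. by apply: filterS2 => x fg gh lx; rewrite fg// gh. Qed.

Lemma ae_eq_onD l f f' g g' : ae_eq_on l f f' -> ae_eq_on l g g' ->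
  ae_eq_on l (fun x => f x + g x) (fun x => f' x + g' x).
Proof. by apply: filterS2 => x ff gg lx; rewrite ff// gg. Qed.

Lemma ae_eq_onM l f f' g g' : ae_eq_on l f f' -> ae_eq_on l g g' ->
  ae_eq_on l (fun x => f x * g x) (fun x => f' x * g' x).
Proof. by apply: filterS2 => x ff gg lx; rewrite ff// gg. Qed.

Lemma ae_eq_onZ l c f f' : ae_eq_on l f f' ->
  ae_eq_on l (fun x => c * f x) (fun x => c * f' x).
Proof. by apply: filterS => x ff lx; rewrite ff. Qed.

Lemma rint_ae l f g : ae_eq_on l f g -> rint 0 l f = rint 0 l g.
Proof.
move=> fg; rewrite /rint; congr fine; apply: ae_eq_integralW.
by apply: filterS fg => x /[apply] ->.
Qed.

Lemma eq_rint (a b : R) f g : (forall x, a <= x <= b -> f x = g x) ->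
  rint a b f = rint a b g.
Proof.
move=> fg; congr fine; apply: eq_integral => x.
by rewrite inE /itv /= in_itv/= => /fg ->.
Qed.

Definition integ (a b : R) f := mu.-integrable (itv a b) (EFin \o f).

Lemma integD (a b : R) f g : integ a b f -> integ a b g ->
  integ a b (fun x => f x + g x).
Proof. by move=> fi gi; exact: (integrableD (measurable_cc a b) fi gi). Qed.

Lemma integZ (a b c : R) f : integ a b f -> integ a b (fun x => c * f x).
Proof. by move=> fi; exact: (integrableZl (measurable_cc a b) c fi). Qed.

Lemma rintD (a b : R) f g : integ a b f -> integ a b g ->
  rint a b (fun x => f x + g x) = rint a b f + rint a b g.
Proof. by move=> fi gi; exact: (RintegralD (measurable_cc a b) fi gi). Qed.

Lemma rintZ (a b c : R) f : integ a b f ->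
  rint a b (fun x => c * f x) = c * rint a b f.
Proof. by move=> fi; exact: (RintegralZl c (measurable_cc a b) fi). Qed.

Lemma rint_ge0 (a b : R) f : (forall x, a <= x <= b -> 0 <= f x) ->
  0 <= rint a b f.
Proof.
by move=> f0; apply: Rintegral_ge0 => x; rewrite /itv/= in_itv/=; exact: f0.
Qed.

Lemma le_rint (a b : R) f g : integ a b f -> integ a b g ->
  (forall x, a <= x <= b -> f x <= g x) -> rint a b f <= rint a b g.
Proof.
move=> fi gi fg; apply: (le_Rintegral (measurable_cc a b) fi gi) => x.
by rewrite /itv/= in_itv/=; exact: fg.
Qed.

Lemma rint_cst (a b c : R) : a <= b -> rint a b (fun=> c) = c * (b - a).
Proof.
move=> ab; rewrite /rint -[LHS]/(Rintegral _ _ _) Rintegral_cst; last first.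
  exact: measurable_cc.
rewrite /itv/= lebesgue_measure_itv/= lte_fin; case: ltgtP ab => //= -> _.
by rewrite subrr.
Qed.

Lemma integ_cst (a b c : R) : integ a b (fun=> c).
Proof.
apply: (@measurable_bounded_integrable _ _ _ mu).
- exact: measurable_cc.
- by rewrite /itv/= lebesgue_measure_itv/=; case: ifP => //= _; rewrite -EFinB ltry.
- exact: measurable_cst.
- by exists `|c|; split=> // M cM x _; exact: ltW.
Qed.

Lemma L2_measurable l f : L2 l f -> measurable_fun (itv 0 l) f.
Proof. by case. Qed.

Lemma L2_sqr_integ l f : L2 l f -> integ 0 l (fun x => f x ^+ 2).
Proof.
move=> [mf fi]; apply/integrableP; split.
  by apply/measurable_EFinP; exact: measurable_funX.
apply: le_lt_trans fi; rewrite le_eqVlt; apply/orP; left; apply/eqP.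
by apply: eq_integral => x _ /=; rewrite ger0_norm// sqr_ge0.
Qed.

Lemma L2P l f : measurable_fun (itv 0 l) f -> integ 0 l (fun x => f x ^+ 2) ->
  L2 l f.
Proof.
move=> mf /integrableP[_ fi]; split => //.
apply: le_lt_trans fi; rewrite le_eqVlt; apply/orP; left; apply/eqP.
by apply: eq_integral => x _ /=; rewrite ger0_norm// sqr_ge0.
Qed.

Lemma integ_le (a b : R) f g : measurable_fun (itv a b) f -> integ a b g ->
  (forall x, a <= x <= b -> `|f x| <= g x) -> integ a b f.
Proof.
move=> mf gi fg; apply: (le_integrable _ _ _ gi).
- exact: measurable_cc.
- exact/measurable_EFinP.
- move=> x; rewrite /itv/= in_itv/= => xab.
  by rewrite lee_fin (le_trans (fg _ xab))// ler_norm.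
Qed.

Lemma L2_mul_integ l f g : L2 l f -> L2 l g -> integ 0 l (fun x => f x * g x).
Proof.
move=> Lf Lg; apply: (integ_le _ (integD (L2_sqr_integ Lf) (L2_sqr_integ Lg))).
  by apply: measurable_funM; exact: L2_measurable.
move=> x _; rewrite ler_norml; have := sqr_ge0 (f x + g x).
by have := sqr_ge0 (f x - g x); nra.
Qed.

Lemma L2_cst l c : L2 l (fun=> c).
Proof. by apply: L2P => //; exact: integ_cst. Qed.

Lemma L2D l f g : L2 l f -> L2 l g -> L2 l (fun x => f x + g x).
Proof.
move=> Lf Lg; apply: L2P.
  by apply: measurable_funD; exact: L2_measurable.
have -> : (fun x => (f x + g x) ^+ 2) =
    (fun x => (f x ^+ 2 + g x ^+ 2) + 2 * (f x * g x)).
  by apply/funext => x; ring.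
apply: integD; first by apply: integD; exact: L2_sqr_integ.
by apply: integZ; exact: L2_mul_integ.
Qed.

Lemma L2Z l c f : L2 l f -> L2 l (fun x => c * f x).
Proof.
move=> Lf; apply: L2P; first by apply: measurable_funM => //; exact: L2_measurable.
have -> : (fun x => (c * f x) ^+ 2) = (fun x => c ^+ 2 * f x ^+ 2).
  by apply/funext => x; rewrite exprMn.
by apply: integZ; exact: L2_sqr_integ.
Qed.

(** The positions of a state carry no measurability of their own, only that of an almost everywhere
    equal representative. On this class [ip] is still bilinear. *)
Definition L2ae l f := exists2 g, L2 l g & ae_eq_on l f g.

Definition ip l f g := rint 0 l (fun x => f x * g x).

Lemma L2_L2ae l f : L2 l f -> L2ae l f.
Proof. by move=> Lf; exists f => //; exact: ae_eq_on_refl. Qed.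

Lemma L2ae_eq l f g : ae_eq_on l f g -> L2ae l g -> L2ae l f.
Proof. by move=> fg [h Lh gh]; exists h => //; exact: ae_eq_on_trans gh. Qed.

Lemma L2aeD l f g : L2ae l f -> L2ae l g -> L2ae l (fun x => f x + g x).
Proof.
by move=> [f' Lf ff] [g' Lg gg]; exists (fun x => f' x + g' x);
  [exact: L2D|exact: ae_eq_onD].
Qed.

Lemma L2aeZ l c f : L2ae l f -> L2ae l (fun x => c * f x).
Proof.
by move=> [f' Lf ff]; exists (fun x => c * f' x);
  [exact: L2Z|exact: ae_eq_onZ].
Qed.

Lemma ip_ae l f f' g g' : ae_eq_on l f f' -> ae_eq_on l g g' ->
  ip l f g = ip l f' g'.
Proof. by move=> ff gg; apply: rint_ae; exact: ae_eq_onM. Qed.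

Lemma ipC l f g : ip l f g = ip l g f.
Proof. by apply: eq_rint => x _; rewrite mulrC. Qed.

Lemma ip_ge0 l f : 0 <= ip l f f.
Proof. by apply: rint_ge0 => x _; rewrite -expr2 sqr_ge0. Qed.

Lemma ipDl l f g h : L2ae l f -> L2ae l g -> L2ae l h ->
  ip l (fun x => f x + g x) h = ip l f h + ip l g h.
Proof.
move=> [f' Lf ff] [g' Lg gg] [h' Lh hh].
rewrite (ip_ae (ae_eq_onD ff gg) hh) (ip_ae ff hh) (ip_ae gg hh).
rewrite -rintD; try exact: L2_mul_integ.
by apply: eq_rint => x _; rewrite mulrDl.
Qed.

Lemma ipZl l c f g : L2ae l f -> L2ae l g ->
  ip l (fun x => c * f x) g = c * ip l f g.
Proof.
move=> [f' Lf ff] [g' Lg gg].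
rewrite (ip_ae (ae_eq_onZ c ff) gg) (ip_ae ff gg).
rewrite -rintZ; last exact: L2_mul_integ.
by apply: eq_rint => x _; rewrite mulrA.
Qed.

Lemma ipDr l f g h : L2ae l f -> L2ae l g -> L2ae l h ->
  ip l f (fun x => g x + h x) = ip l f g + ip l f h.
Proof. by move=> Lf Lg Lh; rewrite ipC ipDl// ipC [in X in _ + X]ipC. Qed.

Lemma ipZr l c f g : L2ae l f -> L2ae l g ->
  ip l f (fun x => c * g x) = c * ip l f g.
Proof. by move=> Lf Lg; rewrite ipC ipZl// ipC. Qed.

Lemma ip_cauchy_schwarz l f g : L2ae l f -> L2ae l g ->
  ip l f g ^+ 2 <= ip l f f * ip l g g.
Proof.
move=> Lf Lg.
(* the quadratic form [|s f + t g|^2], tested at suitable [s] and [t] *)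
have quad s t : 0 <= s ^+ 2 * ip l f f + 2 * (s * t) * ip l f g + t ^+ 2 * ip l g g.
  have := ip_ge0 l (fun x => s * f x + t * g x).
  rewrite ipDl ?ipDr ?ipZl ?ipZr //; try exact: L2aeZ; last first.
    by apply: L2aeD; exact: L2aeZ.
  rewrite (ipC l g f); congr (0 <= _); ring.
have := ip_ge0 l f; rewrite le_eqVlt => /predU1P[f0|f0].
  have [->|fg0] := eqVneq (ip l f g) 0; first by rewrite -f0 mul0r expr0n.
  (* When [f] has norm zero the form is affine in [s]; this [s] gives it the value -1, so a nonzero
     pairing is impossible. *)
  have := quad (- (ip l g g + 1) / (2 * ip l f g)) 1.
  rewrite -f0.
  have -> : (- (ip l g g + 1) / (2 * ip l f g)) ^+ 2 * 0 +
    2 * ((- (ip l g g + 1) / (2 * ip l f g)) * 1) * ip l f g + 1 ^+ 2 * ip l g g = -1.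
    by field.
  by rewrite ler0N1.
(* At these values the form is the squared norm of [f] times the Gram determinant. *)
have := quad (- ip l f g) (ip l f f).
have -> : (- ip l f g) ^+ 2 * ip l f f + 2 * (- ip l f g * ip l f f) * ip l f g
   + ip l f f ^+ 2 * ip l g g = ip l f f * (ip l f f * ip l g g - ip l f g ^+ 2).
  ring.
by rewrite pmulr_rge0// subr_ge0.
Qed.

End L2.

(** * Weak derivatives on an interval *)

Section weak_derivative.
Context (R : realType).
Notation mu := (@lebesgue_measure R).
Implicit Types (l c : R) (f g h : R -> R).

Lemma integS (a b c d : R) f : a <= c -> d <= b -> integ a b f -> integ c d f.
Proof.
move=> ac db fi; apply: (integrableS (measurable_cc a b) (measurable_cc c d) _ fi).
by apply: subset_itv; rewrite bnd_simp.
Qed.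

Lemma wderiv_integ l f g : wderiv l f g -> integ 0 l g.
Proof. by case. Qed.

Lemma rint_itvB l f x y : integ 0 l f -> 0 <= x -> x <= y -> y <= l ->
  rint 0 y f - rint 0 x f = rint x y f.
Proof.
move=> fi x0 xy yl.
have fi' := integS (lexx 0) yl fi.
rewrite [LHS](Rintegral_itvB fi') ?bnd_simp//.
rewrite Rintegral_itv_obnd_cbnd//.
by apply: integrableS (integS x0 (lexx y) fi') => //;
  [exact: measurable_cc|exact: subset_itv_oc_cc].
Qed.

Lemma wderivB l f g x y : wderiv l f g -> 0 <= x -> x <= y -> y <= l ->
  rint x y g = f y - f x.
Proof.
move=> [gi fE] x0 xy yl; rewrite -(rint_itvB gi)//.
have -> : f y = f 0 + rint 0 y g by apply: fE; rewrite yl (le_trans x0).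
have -> : f x = f 0 + rint 0 x g by apply: fE; rewrite x0 (le_trans xy).
by ring.
Qed.

Lemma wderiv_continuous l f g : 0 < l -> wderiv l f g ->
  {within itv 0 l, continuous f}.
Proof.
move=> l0 [gi fE].
apply: (@subspace_eq_continuous _ _ _ (fun x => f 0 + rint 0 x g)).
  by move=> x; rewrite inE /itv/= in_itv/= => /fE /esym.
have := parameterized_integral_continuous (ltW l0) gi.
move=> cg x; apply: (@continuousD _ _ (subspace (itv 0 l)) (fun=> f 0)
  (fun x => rint 0 x g)); first exact: cst_continuous.
exact: cg.
Qed.

Lemma wderiv_measurable l f g : 0 < l -> wderiv l f g ->
  measurable_fun (itv 0 l) f.
Proof.
move=> l0 fg; apply: subspace_continuous_measurable_fun.
  exact: measurable_cc.
exact: wderiv_continuous fg.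
Qed.

Lemma wderiv_bounded l f g : wderiv l f g ->
  exists2 M, 0 <= M & forall x, 0 <= x <= l -> `|f x| <= M.
Proof.
move=> [gi fE].
have gi' : integ 0 l (fun x => `|g x|) by exact: integrable_norm gi.
exists (`|f 0| + rint 0 l (fun x => `|g x|)).
  by rewrite addr_ge0// rint_ge0.
move=> x /[dup] /fE -> /andP[x0 xl]; rewrite (le_trans (ler_normD _ _))// lerD2l.
apply: (le_trans (le_normr_Rintegral (measurable_cc 0 x) (integS (lexx 0) xl gi))).
rewrite -[X in X <= _]/(rint 0 x (fun x => `|g x|)).
by rewrite -subr_ge0 (rint_itvB gi')// rint_ge0.
Qed.

Lemma wderiv_L2 l f g : 0 < l -> wderiv l f g -> L2 l f.
Proof.
move=> l0 fg; have [M M0 fM] := wderiv_bounded fg.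
have mf := wderiv_measurable l0 fg.
apply: L2P => //; apply: (integ_le _ (integ_cst 0 l (M ^+ 2))).
  exact: measurable_funX.
by move=> x /fM fx; rewrite normrX lerXn2r// nnegrE.
Qed.

(** If the values differ at [z], continuity keeps the functions apart on a relative neighbourhood of
    [z]. That neighbourhood contains an open interval of positive length, yet it would have to lie
    in a null set. *)
Lemma continuous_ae_eq l f g : 0 < l ->
  {within itv 0 l, continuous f} -> {within itv 0 l, continuous g} ->
  ae_eq_on l f g -> forall z, 0 <= z <= l -> f z = g z.
Proof.
move=> l0 cf cg [N [mN N0 fgN]] z z0l; apply: contrapT => /eqP fgz.
have zI : itv 0 l z by rewrite /itv/= in_itv.
have e0 : 0 < `|f z - g z| / 2 by rewrite divr_gt0// normr_gt0 subr_eq0.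
move/(subspace_continuousP (itv 0 l) f) : cf => /(_ z zI) /cvgrPdist_lt /(_ _ e0).
move/(subspace_continuousP (itv 0 l) g) : cg => /(_ z zI) /cvgrPdist_lt /(_ _ e0).
move=> /nbhs_ballP[d1 /= d10 gd] /nbhs_ballP[d2 /= d20 fd].
pose d := Num.min d1 d2.
have d0 : 0 < d by rewrite lt_min d10.
(* Truncating to [0, l] covers the case where [z] is an endpoint; the interval stays nonempty
   because [l] is positive. *)
pose a := Num.max 0 (z - d); pose b := Num.min l (z + d).
have ab : a < b.
  move/andP : z0l => [z0 zl].
  by rewrite /a /b gt_max !lt_min; apply/andP; split; apply/andP; split; lra.
have : (mu `]a, b[ <= mu N)%E.
  apply: le_measure; rewrite ?inE//.
  move=> x /=; rewrite in_itv/= => /andP[].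
  rewrite /a gt_max /b lt_min => /andP[x0 xzd] /andP[xl xzd'].
  have xI : itv 0 l x by rewrite /itv/= in_itv/= !ltW.
  have xzd1 : `|z - x| < d1 /\ `|z - x| < d2.
    have : `|z - x| < d by rewrite ltr_norml; apply/andP; split; lra.
    by rewrite lt_min => /andP[].
  have {}gd : `|g z - g x| < `|f z - g z| / 2 by apply: gd => //; case: xzd1.
  have {}fd : `|f z - f x| < `|f z - g z| / 2 by apply: fd => //; case: xzd1.
  apply: fgN => /= /(_ xI) fgx; move: fd gd; rewrite fgx.
  rewrite (distrC (g z)) => fd gd.
  have := ler_normD (f z - g x) (g x - g z); rewrite addrA subrK.
  lra.
rewrite N0 lebesgue_measure_itv/= lte_fin ab -EFinD lee_fin; lra.
Qed.

(** By Lebesgue differentiation, [h] is almost everywhere the derivative of its primitive, which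
    vanishes on [0, l]. *)
Lemma rint0_ae_eq0 l h : integ 0 l h ->
  (forall z, 0 <= z <= l -> rint 0 z h = 0) -> ae_eq_on l h (fun=> 0).
Proof.
move=> hi h0.
(* Extension by zero gives an integrable function on the whole line, the setting of [FTC1]. *)
pose k := h \_ (itv 0 l).
have ki : mu.-integrable setT (EFin \o k).
  rewrite /k -restrict_EFin; exact/(integrable_mkcond _ (measurable_cc 0 l)).
have kl : locally_integrable setT k.
  exact: (integrable_locally (measurable_cc 0 l) hi).
have kE x : 0 <= x <= l -> rint 0 x k = rint 0 x h.
  move=> /andP[x0 xl]; apply: eq_rint => y /andP[y0 yx].
  by rewrite /k patchE mem_set// /itv/= in_itv/= y0 (le_trans yx).
have := @FTC1 R k (BLeft 0) _ kl.
have ki' y : mu.-integrable [set` Interval (BLeft 0) (BRight y)] (EFin \o k).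
  by apply: (integrableS _ _ _ ki) => //; exact: measurable_cc.
move=> /(_ ki').
(* The primitive is known to vanish only on [0, l], so its two-sided derivative is computed at
   interior points; the two endpoints form a null set. *)
have neq (r : R) : {ae mu, forall x, x <> r}.
  exists [set r]; split => //; first exact: lebesgue_measure_set1.
  by move=> x /= /contrapT.
apply: filterS3 (neq 0) (neq l) => x x0 xl Fx.
rewrite /itv/= in_itv/= => /andP[xge xle].
have {}x0 : 0 < x by rewrite lt_neqAle xge andbT eq_sym; exact/eqP.
have {}xl : x < l by rewrite lt_neqAle xle andbT; exact/eqP.
have [|_] := Fx; first by rewrite lte_fin.
rewrite {2}/k patchE mem_set; last by rewrite /itv/= in_itv/= xge.
move=> <-; rewrite derive1E.
rewrite (@near_eq_derive _ _ _ _ (fun=> 0)) ?derive_cst//.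
near=> y.
have yl : 0 <= y <= l.
  apply/andP; split; first by apply: ltW; near: y; exact: lt_nbhsr.
  by near: y; exact: lt_le_nbhsl.
by rewrite -[LHS]/(rint 0 y k) kE// h0.
Unshelve. all: by end_near. Qed.

Lemma wderiv_unique l f g f' g' : wderiv l f g -> wderiv l f' g' ->
  (forall z, 0 <= z <= l -> f z = f' z) -> ae_eq_on l g g'.
Proof.
move=> fg fg' ff'.
have gi := wderiv_integ fg; have gi' := wderiv_integ fg'.
have hi : integ 0 l (fun x => g x + -1 * g' x).
  by apply: integD => //; exact: integZ.
have /(rint0_ae_eq0 hi) : forall z, 0 <= z <= l ->
    rint 0 z (fun x => g x + -1 * g' x) = 0.
  move=> z /andP[z0 zl].
  rewrite rintD ?rintZ; try apply: integZ; try exact: integS (lexx 0) zl _.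
  rewrite (wderivB fg)// (wderivB fg')// !ff' ?z0 ?zl ?lexx ?(le_trans z0)//.
  ring.
by apply: filterS => x /[apply] h; lra.
Qed.

Lemma wderivD l f g f' g' : wderiv l f g -> wderiv l f' g' ->
  wderiv l (fun x => f x + f' x) (fun x => g x + g' x).
Proof.
move=> [gi fE] [gi' fE']; split; first exact: integD.
move=> z /[dup] zl /andP[z0 zl'].
rewrite rintD; try exact: integS (lexx 0) zl' _.
by rewrite fE// fE'//; ring.
Qed.

Lemma wderivZ l c f g : wderiv l f g ->
  wderiv l (fun x => c * f x) (fun x => c * g x).
Proof.
move=> [gi fE]; split; first exact: integZ.
move=> z /[dup] zl /andP[z0 zl'].
rewrite rintZ; last exact: integS (lexx 0) zl' _.
by rewrite fE//; ring.
Qed.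

End weak_derivative.

(** * Integration by parts and the Poincare inequality *)

Section integration_by_parts.
Context (R : realType).
Notation mu := (@lebesgue_measure R).
Implicit Types (l c : R) (f g h : R -> R).

Lemma integ_EFin (a b : R) f : integ a b f ->
  (\int[mu]_(x in itv a b) (f x)%:E)%E = (rint a b f)%:E.
Proof.
by move=> fi; rewrite /rint fineK// integrable_fin_num//; exact: measurable_cc.
Qed.

Lemma integrable_patch (a b : R) f : integ a b f ->
  mu.-integrable setT (EFin \o (f \_ (itv a b))).
Proof.
by move=> fi; rewrite -restrict_EFin; exact/(integrable_mkcond _ (measurable_cc a b)).
Qed.

Lemma integral_patchE (D : set (measurableTypeR R)) f :
  (\int[mu]_x ((f \_ D) x)%:E = \int[mu]_(x in D) (f x)%:E)%E.
Proof. by rewrite [RHS]integral_mkcond -/(EFin \o f) restrict_EFin. Qed.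

Lemma integral_patch (a b : R) f : integ a b f ->
  (\int[mu]_x ((f \_ (itv a b)) x)%:E)%E = (rint a b f)%:E.
Proof. by move=> fi; rewrite integral_patchE integ_EFin. Qed.

(* Fubini for [f x * g y] on the triangle [0 <= x <= y <= l]; this is integration
   by parts for functions whose derivatives are merely integrable. *)
Lemma triangle_fubini l f g : integ 0 l f -> integ 0 l g ->
  (\int[mu]_(x in itv 0 l) (f x * rint x l g)%:E =
   \int[mu]_(y in itv 0 l) (g y * rint 0 y f)%:E)%E.
Proof.
move=> fi gi.
pose a := f \_ (itv 0 l); pose b := g \_ (itv 0 l).
have ai : mu.-integrable setT (EFin \o a) by exact: integrable_patch.
have bi : mu.-integrable setT (EFin \o b) by exact: integrable_patch.
have ma : measurable_fun setT a by apply/measurable_EFinP; exact: measurable_int ai.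
have mb : measurable_fun setT b by apply/measurable_EFinP; exact: measurable_int bi.
(* Since [a] and [b] vanish outside [0, l], the condition [p.1 <= p.2] alone cuts out the
   triangle. *)
pose J (p : measurableTypeR R * measurableTypeR R) : \bar R :=
  (if p.1 <= p.2 then a p.1 * b p.2 else 0)%:E.
have mJ : measurable_fun setT J.
  apply/measurable_EFinP; apply: measurable_fun_ifT => //.
    exact: measurable_fun_ler.
  by apply: measurable_funM; exact: measurableT_comp.
(* Tonelli: the absolute value of [J] is at most the tensor product of those of [a] and [b]. *)
have Ji : (mu \x mu)%E.-integrable setT J.
  apply: (@integrable12ltyP _ _ _ _ _ mu mu J mJ).2.
  apply: (@le_lt_trans _ _
    (\int[mu]_x (`|a x|%:E * \int[mu]_y `|b y|%:E))%E).
    apply: ge0_le_integral_ae => //.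
    - by move=> x _; exact: integral_ge0.
    - by move=> x _; rewrite mule_ge0// integral_ge0.
    - apply: aeW => x _.
      rewrite -ge0_integralZl//; last first.
        by apply/measurable_EFinP; exact: measurableT_comp.
      apply: ge0_le_integral_ae => //.
      apply: aeW => y _; rewrite /J/= -EFinM lee_fin; case: ifPn => _.
        by rewrite normrM.
      by rewrite normr0 mulr_ge0.
  have /integrableP[_ bfin] := bi; have /integrableP[_ afin] := ai.
  rewrite ge0_integralZr//; last 2 first.
  - by apply/measurable_EFinP; exact: measurableT_comp.
  - exact: integral_ge0.
  by rewrite lte_mul_pinfty// ?integral_ge0// ge0_fin_numE// integral_ge0.
have inner1 x : (\int[mu]_y J (x, y) =
    (((fun x => f x * rint x l g)%R \_ (itv 0 l)) x)%:E)%E.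
  have [xl|xl] := pselect (itv 0 l x); last first.
    rewrite patchE memNset//; apply: integral0_eq => y _.
    by rewrite /J/= /a patchE memNset// mul0r if_same.
  move: (xl); rewrite /itv/= in_itv/= => /andP[x0 xl'].
  rewrite patchE mem_set// EFinM -integral_patch; last exact: integS gi.
  rewrite -integralZl//; last by apply: integrable_patch; exact: integS gi.
  apply: eq_integral => y _; rewrite /J/= /a patchE mem_set// -EFinM; congr EFin.
  rewrite /b !patchE /=.
  have [xy|yx] := leP x y; last first.
    by rewrite memNset ?mulr0// /itv/= in_itv/= leNgt yx.
  have [yl|ly] := leP y l.
    by rewrite !mem_set// /itv/= in_itv/= ?xy ?yl// (le_trans x0 xy).
  by rewrite !memNset// /itv/= in_itv/= !(leNgt y) ly andbF.
have inner2 y : (\int[mu]_x J (x, y) =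
    (((fun y => g y * rint 0 y f)%R \_ (itv 0 l)) y)%:E)%E.
  have [yl|yl] := pselect (itv 0 l y); last first.
    rewrite patchE memNset//; apply: integral0_eq => x _.
    by rewrite /J/= /b patchE memNset// mulr0 if_same.
  move: (yl); rewrite /itv/= in_itv/= => /andP[y0 yl'].
  rewrite patchE mem_set// EFinM -integral_patch; last exact: integS fi.
  rewrite -integralZl//; last by apply: integrable_patch; exact: integS fi.
  apply: eq_integral => x _; rewrite /J/= /b patchE mem_set// -EFinM; congr EFin.
  rewrite /a !patchE /= mulrC.
  have [xy|yx] := leP x y; last first.
    by rewrite memNset ?mulr0// /itv/= in_itv/= (leNgt x) yx andbF.
  have [x0|x0] := leP 0 x.
    by rewrite !mem_set// /itv/= in_itv/= ?xy ?x0// (le_trans xy yl').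
  by rewrite !memNset// /itv/= in_itv/= !(leNgt 0) x0.
have := Fubini Ji.
under eq_integral do rewrite inner1.
under [RHS]eq_integral do rewrite inner2.
by rewrite !integral_patchE.
Qed.

Lemma wderiv_mul_integ l f f' g g' : 0 < l -> wderiv l f f' -> wderiv l g g' ->
  integ 0 l (fun x => f' x * g x).
Proof.
move=> l0 ff gg; have [M M0 gM] := wderiv_bounded gg.
have fi := wderiv_integ ff.
have fi' : integ 0 l (fun x => `|f' x|) by exact: integrable_norm fi.
apply: (integ_le _ (integZ M fi')).
  apply: measurable_funM; last exact: wderiv_measurable gg.
  by apply/measurable_EFinP; exact: measurable_int fi.
by move=> x /gM gx; rewrite normrM mulrC ler_wpM2r.
Qed.

(** In the triangle identity for [f'] and [g'] the inner integrals are increments of [g] and [f].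
    Expanding them leaves the boundary terms. *)
Lemma wderiv_by_parts l f f' g g' : 0 < l -> wderiv l f f' -> wderiv l g g' ->
  rint 0 l (fun x => f' x * g x) =
  f l * g l - f 0 * g 0 - rint 0 l (fun x => f x * g' x).
Proof.
move=> l0 ff gg.
have fi := wderiv_integ ff; have gi := wderiv_integ gg.
have fgi := wderiv_mul_integ l0 ff gg; have gfi := wderiv_mul_integ l0 gg ff.
have l00 := ltW l0.
have := congr1 fine (triangle_fubini fi gi).
rewrite -[LHS]/(rint 0 l (fun x => f' x * rint x l g')).
rewrite -[RHS]/(rint 0 l (fun x => g' x * rint 0 x f')).
have -> : rint 0 l (fun x => f' x * rint x l g') =
    rint 0 l (fun x => g l * f' x + -1 * (f' x * g x)).
  apply: eq_rint => x /andP[x0 xl]; rewrite (wderivB gg)//; ring.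
have -> : rint 0 l (fun x => g' x * rint 0 x f') =
    rint 0 l (fun x => g' x * f x + - f 0 * g' x).
  apply: eq_rint => x /andP[x0 xl]; rewrite (wderivB ff)//; ring.
rewrite !rintD; try exact: integZ; try by [].
rewrite !rintZ// (wderivB ff)// (wderivB gg)//.
have -> : rint 0 l (fun x => g' x * f x) = rint 0 l (fun x => f x * g' x).
  by apply: eq_rint => x _; rewrite mulrC.
by move=> h; lra.
Qed.

(** As [f 0 = 0], the value [f x] is the pairing of 1 with [g] on [0, x], so Cauchy-Schwarz bounds
    its square by x times the squared norm of [g]. Integrating over [0, l] gives the second factor
    [l]. *)
Lemma poincare l f g : 0 < l -> wderiv l f g -> f 0 = 0 -> L2 l g ->
  L2norm2 l f <= l ^+ 2 * L2norm2 l g.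
Proof.
move=> l0 fg f0 Lg.
have Lf := wderiv_L2 l0 fg.
have fb x : 0 <= x <= l -> f x ^+ 2 <= l * L2norm2 l g.
  move=> /andP[x0 xl].
  have Lgx : L2 x g.
    have [mg _] := Lg; apply: L2P; last exact: integS (L2_sqr_integ Lg).
    apply: measurable_funS mg; first exact: measurable_cc.
    by apply: subset_itv; rewrite bnd_simp.
  have -> : f x = ip x (fun=> 1) g.
    have [_ ->] := fg; last by rewrite x0.
    by rewrite f0 add0r; apply: eq_rint => y _; rewrite mul1r.
  have := ip_cauchy_schwarz (L2_L2ae (L2_cst x 1)) (L2_L2ae Lgx).
  move=> /le_trans; apply.
  have -> : ip x (fun=> 1) (fun=> 1) = x.
    by rewrite /ip mulr1 rint_cst// subr0 mul1r.
  apply: ler_pM => //; first exact: ip_ge0.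
  rewrite -subr_ge0 -[L2norm2 l g]/(rint 0 l (fun x => g x ^+ 2)).
  rewrite -[ip x g g]/(rint 0 x (fun x => g x ^+ 2)).
  by rewrite (rint_itvB (L2_sqr_integ Lg))// rint_ge0// => y _; exact: sqr_ge0.
rewrite -[X in X <= _]/(rint 0 l (fun x => f x ^+ 2)).
have := le_rint (L2_sqr_integ Lf) (integ_cst 0 l (l * L2norm2 l g)) fb.
rewrite rint_cst; last exact: ltW.
by rewrite subr0 mulrAC expr2.
Qed.

End integration_by_parts.

(** * Sobolev representatives and clamped functions *)

Section sobolev.
Context (R : realType).
Notation mu := (@lebesgue_measure R).
Implicit Types (l c : R) (f g w v : R -> R) (d e : nat -> R -> R).

Lemma Hk_L2 l k w d j : 0 < l -> Hk_with l k w d -> (j <= k)%N -> L2 l (d j).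
Proof.
move=> l0 [[dd dk] _]; rewrite leq_eqVlt => /predU1P[->//|jk].
exact: wderiv_L2 (dd _ jk).
Qed.

Lemma Hk_le l k m w d : 0 < l -> Hk_with l m w d -> (k <= m)%N -> Hk_with l k w d.
Proof.
move=> l0 H km; have [[dd dm] wd] := H; split=> //; split.
  by move=> i ik; apply: dd; exact: leq_trans km.
exact: Hk_L2 H km.
Qed.

(** Induction on the order: almost everywhere equal continuous members of the chains coincide on
    [0, l], hence their weak derivatives agree almost everywhere. The two chains may have different
    lengths. *)
Lemma Hk_unique l k m w d e : 0 < l -> Hk_with l k w d -> Hk_with l m w e ->
  forall j, (j <= k)%N -> (j <= m)%N -> ae_eq_on l (d j) (e j).
Proof.
move=> l0 [[dd _] wd] [[ee _] we]; elim=> [_ _|j IH jk jm].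
  exact: ae_eq_on_trans (ae_eq_on_sym wd) we.
apply: (wderiv_unique (dd _ jk) (ee _ jm)).
apply: continuous_ae_eq => //.
- exact: wderiv_continuous (dd _ jk).
- exact: wderiv_continuous (ee _ jm).
- by apply: IH; exact: ltnW.
Qed.

(** The choice made by [der] is harmless: any chain of sufficient length computes it up to a null
    set. In particular, an H^4 chain, which carries the conditions at the free end, also computes
    the curvature in the energy. *)
Lemma der_ae l k m w d j : 0 < l -> Hk_with l m w d -> (k <= m)%N ->
  (j <= k)%N -> ae_eq_on l (der l k w j) (d j).
Proof.
move=> l0 H km jk; rewrite /der; case: pselect => [P|[]]; last first.
  by exists d; exact: Hk_le km.
case: (cid P) => /= e He.
by apply: (Hk_unique l0 He H) => //; exact: leq_trans km.
Qed.

Lemma Hk_withD l k w w' d d' : 0 < l -> Hk_with l k w d -> Hk_with l k w' d' ->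
  Hk_with l k (fun x => w x + w' x) (fun j x => d j x + d' j x).
Proof.
move=> l0 [[dd dk] wd] [[dd' dk'] wd']; split; last exact: ae_eq_onD.
by split=> [i ik|]; [apply: wderivD; [exact: dd|exact: dd']|exact: L2D].
Qed.

Lemma Hk_withZ l k c w d : Hk_with l k w d ->
  Hk_with l k (fun x => c * w x) (fun j x => c * d j x).
Proof.
move=> [[dd dk] wd]; split; last exact: ae_eq_onZ.
by split=> [i ik|]; [apply: wderivZ; exact: dd|exact: L2Z].
Qed.

Lemma Hk_L2ae l k w d : 0 < l -> Hk_with l k w d -> L2ae l w.
Proof. by move=> l0 H; exists (d 0%N); [exact: (Hk_L2 l0 H)|case: H]. Qed.

Lemma der_L2ae l k m w d j : 0 < l -> Hk_with l m w d -> (k <= m)%N ->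
  (j <= k)%N -> L2ae l (der l k w j).
Proof.
move=> l0 H km jk; apply: (L2ae_eq (der_ae l0 H km jk)).
by apply: L2_L2ae; apply: (Hk_L2 l0 H); exact: leq_trans km.
Qed.

Lemma L2norm2E l f : L2norm2 l f = ip l f f.
Proof. by []. Qed.

Lemma L2norm2_ae l f g : ae_eq_on l f g -> L2norm2 l f = L2norm2 l g.
Proof. by move=> fg; rewrite !L2norm2E; exact: ip_ae. Qed.

Lemma L2norm2_ge0 l f : 0 <= L2norm2 l f.
Proof. exact: ip_ge0. Qed.

(* For a clamped [v] and a [w] with free end at [l], the boundary terms vanish. *)
Lemma ip_beam l w v d e : 0 < l -> Hk_with l 4 w d -> Hk_with l 2 v e ->
  d 2%N l = 0 -> d 3%N l = 0 -> e 0%N 0 = 0 -> e 1%N 0 = 0 ->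
  ip l v (der l 4 w 4) = ip l (der l 2 w 2) (der l 2 v 2).
Proof.
move=> l0 Hw Hv d2 d3 e0 e1.
have [[dd _] _] := Hw; have [[ee _] ve] := Hv.
rewrite (ip_ae ve (der_ae l0 Hw (leqnn 4) (leqnn 4))).
rewrite (ip_ae (der_ae l0 Hw _ (leqnn 2)) (der_ae l0 Hv (leqnn 2) (leqnn 2)))//.
rewrite ipC /ip (wderiv_by_parts l0 (dd 3%N isT) (ee 0%N isT)).
rewrite (wderiv_by_parts l0 (dd 2%N isT) (ee 1%N isT)) d2 d3 e0 e1; ring.
Qed.

(** The Poincare inequality applied to w' gives the factor [l ^+ 2]; applied once more to w it gives
    [l ^+ 4]. *)
Lemma H2norm_le l w : 0 < l -> inH2_clamped l w ->
  H2norm l w <= Num.sqrt ((l ^+ 4 + l ^+ 2 + 1) * L2norm2 l (der l 2 w 2)).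
Proof.
move=> l0 [d [H [d0 d1]]]; rewrite /H2norm ler_wsqrtr//.
have [[dd d2] wd] := H.
rewrite (L2norm2_ae wd).
rewrite (L2norm2_ae (der_ae l0 H (leqnn 2) (isT : 1 <= 2)%N)).
rewrite (L2norm2_ae (der_ae l0 H (leqnn 2) (leqnn 2))).
have p1 := poincare l0 (dd 1%N isT) d1 d2.
have p0 := poincare l0 (dd 0%N isT) d0 (wderiv_L2 l0 (dd 1%N isT)).
have l20 : 0 <= l ^+ 2 by exact: sqr_ge0.
have := ler_wpM2l l20 p1.
have -> : l ^+ 4 = l ^+ 2 * l ^+ 2 by ring.
lra.
Qed.

End sobolev.

(** * Derivatives on the closed half-line *)

Section half_line_derivative.
Context (R : realType).
Implicit Types (t c : R) (q : R -> R).

(* difference quotients are restricted to [0, +oo[, so that at [t = 0] the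
   derivative is one-sided *)
Definition hderiv t q c := forall eps, 0 < eps -> exists2 dl, 0 < dl &
  forall h, h != 0 -> `|h| < dl -> 0 <= t + h ->
    `|h^-1 * (q (t + h) - q t) - c| < eps.

Lemma hderivD t q q' c c' : hderiv t q c -> hderiv t q' c' ->
  hderiv t (fun s => q s + q' s) (c + c').
Proof.
move=> Hq Hq' eps eps0.
have e2 : 0 < eps / 2 by rewrite divr_gt0.
have [d1 d10 H1] := Hq _ e2; have [d2 d20 H2] := Hq' _ e2.
exists (Num.min d1 d2); first by rewrite lt_min d10.
move=> h h0; rewrite lt_min => /andP[hd1 hd2] th.
have -> : h^-1 * (q (t + h) + q' (t + h) - (q t + q' t)) - (c + c') =
  (h^-1 * (q (t + h) - q t) - c) + (h^-1 * (q' (t + h) - q' t) - c') by ring.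
by rewrite (le_lt_trans (ler_normD _ _))// [eps]splitr ltrD// ?H1 ?H2.
Qed.

Lemma hderivZ t q c k : 0 < k -> hderiv t q c -> hderiv t (fun s => k * q s) (k * c).
Proof.
move=> k0 Hq eps eps0.
have [d d0 H] := Hq (eps / k) (divr_gt0 eps0 k0).
exists d => // h h0 hd th.
have -> : h^-1 * (k * q (t + h) - k * q t) - k * c =
  k * (h^-1 * (q (t + h) - q t) - c) by ring.
by rewrite normrM gtr0_norm// mulrC -ltr_pdivlMr// H.
Qed.

(** For positive times the quotients are two-sided, so the usual derivative criterion for
    monotonicity applies on the open interval. At 0 the one-sided derivative supplies the missing
    right continuity. *)
Lemma hderiv_le0 q : (forall t, 0 <= t -> exists2 c, c <= 0 & hderiv t q c) ->
  forall t, 0 <= t -> q t <= q 0.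
Proof.
move=> dq T; rewrite le_eqVlt => /predU1P[<-//|T0].
have qder x : 0 < x -> derivable q x 1 /\ derive1 q x <= 0.
  move=> x0; have [c c0 Hc] := dq x (ltW x0).
  have : h^-1 *: (q (h *: 1 + x) - q x) @[h --> 0^'] --> c.
    apply/cvgrPdist_lt => e e0.
    have [d d0 Hd] := Hc e e0.
    (* The bound by [x] keeps [x + h] in the half-line. *)
    exists (Num.min d x) => /=; first by rewrite lt_min d0.
    move=> h; rewrite /= sub0r normrN lt_min => /andP[hd hx] h0.
    rewrite distrC /GRing.scale/= mulr1 addrC [h + x]addrC addrC.
    apply: Hd => //; have := ler_norm (- h); rewrite normrN; lra.
  move=> cv; split; first by apply/cvg_ex; exists c.
  by rewrite derive1E /derive (cvg_lim _ cv).
have qcont x : 0 < x -> {for x, continuous q}.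
  by move=> /qder[qx _]; apply: differentiable_continuous; exact/derivable1_diffP.
have q0 : q @ 0^'+ --> q 0.
  have [c c0 Hc] := dq 0 (lexx 0); have [d d0 Hd] := Hc 1 ltr01.
  apply/cvgrPdist_lt => e e0.
  (* Quotients within 1 of [c] are bounded by this constant, so the increment of [q] at 0 is
     O(h). *)
  have M0 : 0 < `|c| + 1 by rewrite ltr_wpDl.
  near=> h.
  have h0 : 0 < h by near: h; exact: nbhs_right_gt.
  have hd : `|h| < d.
    by rewrite gtr0_norm//; near: h; exact: nbhs_right_lt.
  have := Hd h (lt0r_neq0 h0) hd; rewrite add0r => /(_ (ltW h0)) Hh.
  have -> : q 0 - q h = - (h * ((h^-1 * (q h - q 0) - c) + c)).
    by field; exact: lt0r_neq0.
  rewrite normrN normrM gtr0_norm// mulrC -ltr_pdivlMr//.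
  apply: (@lt_trans _ _ (`|c| + 1)).
    by rewrite addrC (le_lt_trans (ler_normD _ _))// ltrD2l.
  rewrite ltr_pdivlMr// mulrC -ltr_pdivlMr//; near: h; apply: nbhs_right_lt.
  by rewrite divr_gt0.
have qc : {within `[0, T], continuous q}.
  apply/(continuous_within_itvP _ T0); split => //.
    by move=> x; rewrite in_itv/= => /andP[x0 _]; exact: qcont.
  exact/cvg_at_left_filter/qcont.
have qd x : x \in `]0, T[%R -> derivable q x 1.
  by rewrite in_itv/= => /andP[/qder[]].
have qd0 x : x \in `]0, T[%R -> derive1 q x <= 0.
  by rewrite in_itv/= => /andP[/qder[]].
by apply: (ler0_derive1_le_cc qd qd0 qc); rewrite ?in_itv/= ?lexx ltW.
Unshelve. all: by end_near. Qed.

End half_line_derivative.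

(** * The elastic energy along solutions *)

Section energy.
Context (R : realType).
Notation mu := (@lebesgue_measure R).
Implicit Types (p : params R) (x : state R).

Lemma ip_sqrDZ (l c : R) (f g : R -> R) : L2ae l f -> L2ae l g ->
  ip l (fun z => f z + c * g z) (fun z => f z + c * g z) =
  ip l f f + 2 * c * ip l f g + c ^+ 2 * ip l g g.
Proof.
move=> Lf Lg; have Lcg : L2ae l (fun z => c * g z) by exact: L2aeZ.
rewrite ipDl//; last exact: L2aeD.
rewrite (ipDr Lf Lf Lcg) (ipDr Lcg Lf Lcg) !(ipZl _ Lg)// !(ipZr _ _ Lg)//.
by rewrite (ipC l g f); ring.
Qed.

(** Let r be the error of the difference quotient, so that u(t + h) = u(t) + h (f + r). The quotient
    of the squared norm then misses its limit by 2 <u(t), r> + h |f + r|^2, and both terms are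
    small. *)
Lemma hderiv_ip (l t : R) (u : R -> R -> R) (f : R -> R) : 0 <= t ->
  (forall s, 0 <= s -> L2ae l (u s)) -> L2ae l f ->
  (forall eps, 0 < eps -> exists2 dl, 0 < dl &
     forall h, h != 0 -> `|h| < dl -> 0 <= t + h ->
       L2norm2 l (fun z => h^-1 * (u (t + h) z + -1 * u t z) + -1 * f z) < eps) ->
  hderiv t (fun s => L2norm2 l (u s)) (2 * ip l (u t) f).
Proof.
move=> t0 Lu Lf uf eps eps0.
have Lt := Lu t t0.
pose N := ip l (u t) (u t); pose F := ip l f f.
have N0 : 0 <= N by exact: ip_ge0.
have F0 : 0 <= F by exact: ip_ge0.
(* The second bound makes 2 <u(t), r> smaller than eps / 2 by Cauchy-Schwarz, with [N + 1] avoiding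
   a zero denominator; the bound 1 controls |f + r|^2. *)
pose eta := Num.min 1 (eps ^+ 2 / (16 * (N + 1))).
have N1 : 0 < N + 1 by rewrite ltr_wpDl.
have eta0 : 0 < eta by rewrite lt_min ltr01 divr_gt0 ?exprn_gt0// mulr_gt0.
have [d d0 Hd] := uf _ eta0.
have K0 : 0 < 4 * (F + 1) by lra.
exists (Num.min d (eps / (4 * (F + 1)))); first by rewrite lt_min d0 divr_gt0.
move=> h h0; rewrite lt_min => /andP[hd hK] th.
have := Hd h h0 hd th.
set r := (fun z => _); rewrite L2norm2E => r_small.
have Lr : L2ae l r.
  apply: L2aeD; last exact: L2aeZ.
  by apply: L2aeZ; apply: L2aeD; [exact: Lu|exact: L2aeZ].
have uE : u (t + h) = (fun z => u t z + h * (f z + r z)).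
  by apply/funext => z; rewrite /r; field.
clearbody r.
have Lfr : L2ae l (fun z => f z + r z) by exact: L2aeD.
have Lhfr : L2ae l (fun z => h * (f z + r z)) by exact: L2aeZ.
have -> : h^-1 * (L2norm2 l (u (t + h)) - L2norm2 l (u t)) - 2 * ip l (u t) f =
    2 * ip l (u t) r + h * ip l (fun z => f z + r z) (fun z => f z + r z).
  by rewrite !L2norm2E uE ip_sqrDZ// ipDr//; field.
have cs := ip_cauchy_schwarz Lt Lr; have rr0 := ip_ge0 l r.
have b1 : `|2 * ip l (u t) r| < eps / 2.
  suff : `|ip l (u t) r| < eps / 4 by rewrite normrM gtr0_norm//; lra.
  have eps4 : 0 <= eps / 4 by lra.
  rewrite -(@ltr_pXn2r _ 2)// ?nnegrE//.
  rewrite real_normK ?num_real//; apply: (le_lt_trans cs).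
  have : ip l r r < eps ^+ 2 / (16 * (N + 1)).
    by apply: (lt_le_trans r_small); rewrite /eta ge_min lexx orbT.
  rewrite ltr_pdivlMr; last by rewrite mulr_gt0.
  rewrite -/N => H.
  have -> : (eps / 4) ^+ 2 = eps ^+ 2 / 16 by field.
  rewrite ltr_pdivlMr//; nra.
have b2 : ip l (fun z => f z + r z) (fun z => f z + r z) <= 2 * (F + 1).
  (* Nonnegativity of |f - r|^2 bounds the cross term, giving |f + r|^2 <= 2 |f|^2 + 2 |r|^2. *)
  have := ip_ge0 l (fun z => f z + -1 * r z).
  have Lr' : L2ae l (fun z => -1 * r z) by exact: L2aeZ.
  have Lfr' : L2ae l (fun z => f z + -1 * r z) by exact: L2aeD.
  rewrite ip_sqrDZ//.
  have -> : (fun z => f z + r z) = (fun z => f z + 1 * r z).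
    by apply/funext => z; rewrite mul1r.
  rewrite ip_sqrDZ// -/F.
  have r1 : ip l r r < 1 by apply: (lt_le_trans r_small); rewrite /eta ge_min lexx.
  lra.
have b2' := ip_ge0 l (fun z => f z + r z).
have b3 : `|h * ip l (fun z => f z + r z) (fun z => f z + r z)| < eps / 2.
  rewrite normrM (ger0_norm b2').
  apply: (@le_lt_trans _ _ (`|h| * (2 * (F + 1)))); first exact: ler_wpM2l.
  move: hK; rewrite ltr_pdivlMr//; lra.
rewrite (le_lt_trans (ler_normD _ _))//; lra.
Qed.

Definition energy p x :=
  rho p * Ar p * (L2norm2 (ell p) (v1 x) + L2norm2 (ell p) (v2 x)) +
  E p * I p * (L2norm2 (ell p) (der (ell p) 2 (w1 x) 2) +
               L2norm2 (ell p) (der (ell p) 2 (w2 x) 2)).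

Lemma energy_le_Xnorm2 p x : params_ok p -> energy p x <= Xnorm2 p x.
Proof.
move=> [_ [_ [_ [_ [_ [i1 [i2 [i3 [k0 _]]]]]]]]].
rewrite /Xnorm2 -/(energy p x) -addrA lerDl.
by do 3?apply: addr_ge0; apply: mulr_ge0; rewrite ?addr_ge0 ?sqr_ge0// ltW.
Qed.

(** It serves twice: for the initial deviation from equilibrium and for the error of the difference
    quotient in time. *)
Lemma Xnorm_bound p (eta : R) : params_ok p -> 0 < eta ->
  exists2 eps, 0 < eps & forall x, Xnorm p x < eps ->
    energy p x < eta.
Proof.
move=> ok e0; exists (Num.sqrt eta); first by rewrite sqrtr_gt0.
move=> x; rewrite /Xnorm ltr_sqrt// => H.
exact: le_lt_trans (energy_le_Xnorm2 x ok) H.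
Qed.

Lemma energy_parts p x : params_ok p ->
  [/\ rho p * Ar p * L2norm2 (ell p) (v1 x) <= energy p x,
      rho p * Ar p * L2norm2 (ell p) (v2 x) <= energy p x,
      E p * I p * L2norm2 (ell p) (der (ell p) 2 (w1 x) 2) <= energy p x &
      E p * I p * L2norm2 (ell p) (der (ell p) 2 (w2 x) 2) <= energy p x].
Proof.
move=> [r0 [a0 [e0 [i0 _]]]].
have ra : 0 <= rho p * Ar p by rewrite mulr_ge0// ltW.
have ei : 0 <= E p * I p by rewrite mulr_ge0// ltW.
have H1 := mulr_ge0 ra (L2norm2_ge0 (ell p) (v1 x)).
have H2 := mulr_ge0 ra (L2norm2_ge0 (ell p) (v2 x)).
have H3 := mulr_ge0 ei (L2norm2_ge0 (ell p) (der (ell p) 2 (w1 x) 2)).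
have H4 := mulr_ge0 ei (L2norm2_ge0 (ell p) (der (ell p) 2 (w2 x) 2)).
by rewrite /energy !mulrDr; split; lra.
Qed.

Lemma energy_small p (eta : R) : params_ok p -> 0 < eta ->
  exists2 eps, 0 < eps & forall x, energy p x < eps ->
    [/\ L2norm2 (ell p) (v1 x) < eta, L2norm2 (ell p) (v2 x) < eta,
        L2norm2 (ell p) (der (ell p) 2 (w1 x) 2) < eta &
        L2norm2 (ell p) (der (ell p) 2 (w2 x) 2) < eta].
Proof.
move=> ok eta0; have [r0 [a0 [e0 [i0 _]]]] := ok.
have ra : 0 < rho p * Ar p by rewrite mulr_gt0.
have ei : 0 < E p * I p by rewrite mulr_gt0.
exists (Num.min (rho p * Ar p * eta) (E p * I p * eta)).
  by rewrite lt_min !mulr_gt0.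
move=> x; rewrite lt_min => /andP[xra xei].
have [H1 H2 H3 H4] := energy_parts x ok.
by split; [rewrite -(ltr_pM2l ra)|rewrite -(ltr_pM2l ra)|
  rewrite -(ltr_pM2l ei)|rewrite -(ltr_pM2l ei)];
  exact: le_lt_trans _ xra || exact: le_lt_trans _ xei.
Qed.

Lemma L2_shift (l c : R) : L2 l (fun z => z + c).
Proof.
have m : measurable_fun (itv 0 l) (fun z : R => z + c) by exact: measurable_funD.
apply: L2P => //; apply: (integ_le _ (integ_cst 0 l ((l + `|c|) ^+ 2))).
  exact: measurable_funX.
move=> x /andP[x0 xl]; rewrite normrX lerXn2r ?nnegrE//.
  by rewrite addr_ge0// (le_trans x0).
by rewrite (le_trans (ler_normD _ _))// lerD2r ger0_norm.
Qed.

Lemma rintB_L2ae (l : R) (f g f' g' : R -> R) :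
  L2ae l f -> L2ae l g -> L2ae l f' -> L2ae l g' ->
  rint 0 l (fun z => f z * g z - f' z * g' z) = ip l f g - ip l f' g'.
Proof.
move=> [a La fa] [b Lb gb] [a' La' fa'] [b' Lb' gb'].
rewrite (ip_ae fa gb) (ip_ae fa' gb').
rewrite (rint_ae (g := fun z => a z * b z + -1 * (a' z * b' z))); last first.
  apply: filterS2 (ae_eq_onM fa gb) (ae_eq_onM fa' gb') => z H H' zl.
  by rewrite H// H'// mulN1r.
have i1 := L2_mul_integ La Lb; have i2 := L2_mul_integ La' Lb'.
by rewrite rintD ?rintZ ?mulN1r//; exact: integZ.
Qed.

Lemma ip_lin4 (l a b c d : R) (u fa fb fc fd : R -> R) : L2ae l u ->
  L2ae l fa -> L2ae l fb -> L2ae l fc -> L2ae l fd ->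
  ip l u (fun z => (a * fa z + b * fb z) + (c * fc z + d * fd z)) =
  a * ip l u fa + b * ip l u fb + (c * ip l u fc + d * ip l u fd).
Proof.
move=> Lu La Lb Lc Ld.
rewrite !ipDr ?ipZr//; try (by apply: L2aeD; exact: L2aeZ); exact: L2aeZ.
Qed.

(** The left side is the rate that [hderiv_ip] produces term by term, with time derivatives already
    replaced by components of [Fop]. It involves a single state and no time variable. *)
Lemma energy_rate_le0 p x : params_ok p -> inD p x ->
  rho p * Ar p * (2 * ip (ell p) (v1 x) (v1 (Fop p x)) +
                  2 * ip (ell p) (v2 x) (v2 (Fop p x))) +
  E p * I p * (2 * ip (ell p) (der (ell p) 2 (w1 x) 2) (der (ell p) 2 (v1 x) 2) +
               2 * ip (ell p) (der (ell p) 2 (w2 x) 2) (der (ell p) 2 (v2 x) 2))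
  <= 0.
Proof.
move=> [r0 [a0 [e0 [i0 [l0 [_ [_ [_ [_ [_ [n1 [n2 n3]]]]]]]]]]]].
move=> [_ [[d1 [Hw1 [_ [_ [w12 w13]]]]] [[d2 [Hw2 [_ [_ [w22 w23]]]]]
  [[e1 [Hv1 [v10 v11]]] [e2 [Hv2 [v20 v21]]]]]]].
set l := ell p in l0 d1 Hw1 w12 w13 d2 Hw2 w22 w23 e1 Hv1 v10 v11 e2 Hv2 v20 v21 *.
have B1 := ip_beam l0 Hw1 Hv1 w12 w13 v10 v11.
have B2 := ip_beam l0 Hw2 Hv2 w22 w23 v20 v21.
have Lw1 := Hk_L2ae l0 Hw1; have Lw2 := Hk_L2ae l0 Hw2.
have Lv1 := Hk_L2ae l0 Hv1; have Lv2 := Hk_L2ae l0 Hv2.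
have LD1 := der_L2ae l0 Hw1 (leqnn 4) (leqnn 4).
have LD2 := der_L2ae l0 Hw2 (leqnn 4) (leqnn 4).
pose m z := z + ell0 p.
have Lm : L2ae l m by exact/L2_L2ae/L2_shift.
(* Each control term, tested against its velocity, returns the functional that drives it; this is
   the source of the squares. *)
have g1 : gamma1 p x = ip l (v2 x) m by rewrite ipC.
have g2 : gamma2 p x = - ip l (v1 x) m by rewrite ipC.
have g3 : gamma3 p x = ip l (v1 x) (w2 x) - ip l (v2 x) (w1 x).
  by rewrite /gamma3 rintB_L2ae// ipC (ipC _ (w1 x)).
pose c := E p * I p / (rho p * Ar p).
have F1 : ip l (v1 x) (v1 (Fop p x)) = - c * ip l (v1 x) (der l 4 (w1 x) 4) +
    2 * om3 x * ip l (v1 x) (v2 x) + nu2 p * gamma2 p x * ip l (v1 x) m -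
    nu3 p * gamma3 p x * ip l (v1 x) (w2 x).
  have -> : v1 (Fop p x) = (fun z => (- c * der l 4 (w1 x) 4 z +
      2 * om3 x * v2 x z) + (nu2 p * gamma2 p x * m z +
      - (nu3 p * gamma3 p x) * w2 x z)).
    by apply/funext => z; rewrite /Fop/= -/l -/c /m; ring.
  by rewrite ip_lin4//; ring.
have F2 : ip l (v2 x) (v2 (Fop p x)) = - c * ip l (v2 x) (der l 4 (w2 x) 4) -
    2 * om3 x * ip l (v1 x) (v2 x) - nu1 p * gamma1 p x * ip l (v2 x) m +
    nu3 p * gamma3 p x * ip l (v2 x) (w1 x).
  have -> : v2 (Fop p x) = (fun z => (- c * der l 4 (w2 x) 4 z +
      - (2 * om3 x) * v1 x z) + (- (nu1 p * gamma1 p x) * m z +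
      nu3 p * gamma3 p x * w1 x z)).
    by apply/funext => z; rewrite /Fop/= -/l -/c /m; ring.
  by rewrite ip_lin4// (ipC l (v2 x) (v1 x)); ring.
rewrite F1 F2 -B1 -B2.
(* The velocity weight times [c] is the curvature weight, so the stiffness terms cancel after
   [ip_beam]. *)
have EI : E p * I p = rho p * Ar p * c.
  by rewrite /c; field; rewrite !lt0r_neq0.
have m1 : ip l (v2 x) m = gamma1 p x by [].
have m2 : ip l (v1 x) m = - gamma2 p x by rewrite g2 opprK.
rewrite m1 m2 EI.
have -> : ip l (v1 x) (w2 x) = gamma3 p x + ip l (v2 x) (w1 x) by rewrite g3; ring.
have q1 := mulr_ge0 (ltW n1) (sqr_ge0 (gamma1 p x)).
have q2 := mulr_ge0 (ltW n2) (sqr_ge0 (gamma2 p x)).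
have q3 := mulr_ge0 (ltW n3) (sqr_ge0 (gamma3 p x)).
have ra := mulr_gt0 r0 a0.
rewrite -oppr_ge0.
apply: (@le_trans _ _ (2 * (rho p * Ar p) * (nu1 p * gamma1 p x ^+ 2 +
    nu2 p * gamma2 p x ^+ 2 + nu3 p * gamma3 p x ^+ 2))).
  by rewrite !mulr_ge0// ?addr_ge0// ltW.
rewrite le_eqVlt; apply/orP; left; apply/eqP; ring.
Qed.

Lemma inX_Hk p x : inX p x ->
  [/\ exists d, Hk_with (ell p) 2 (w1 x) d, exists d, Hk_with (ell p) 2 (w2 x) d,
      L2ae (ell p) (v1 x) & L2ae (ell p) (v2 x)].
Proof.
move=> [[d [Hd _]] [[e [He _]] [Lv1 Lv2]]].
by split; [exists d|exists e|exact: L2_L2ae|exact: L2_L2ae].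
Qed.

(** [der] is chosen separately for each function, hence linear only up to null sets. This turns the
    curvature part of the X-norm error into the form that [hderiv_ip] expects. *)
Lemma der_diff_quot (l h : R) (w w' v : R -> R) (d d' e : nat -> R -> R) : 0 < l ->
  Hk_with l 2 w d -> Hk_with l 2 w' d' -> Hk_with l 2 v e ->
  L2norm2 l (der l 2 (fun z => h * (w z + -1 * w' z) + -1 * v z) 2) =
  L2norm2 l (fun z => h * (der l 2 w 2 z + -1 * der l 2 w' 2 z) +
                      -1 * der l 2 v 2 z).
Proof.
move=> l0 Hd Hd' He; apply: L2norm2_ae.
have H := Hk_withD l0 (Hk_withZ h (Hk_withD l0 Hd (Hk_withZ (-1) Hd')))
  (Hk_withZ (-1) He).
apply: (ae_eq_on_trans (der_ae l0 H (leqnn 2) (leqnn 2))).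
apply: ae_eq_on_sym; apply: ae_eq_onD.
  apply: ae_eq_onZ; apply: ae_eq_onD; first exact: der_ae Hd _ _.
  by apply: ae_eq_onZ; exact: der_ae Hd' _ _.
by apply: ae_eq_onZ; exact: der_ae He _ _.
Qed.

Lemma energy_hderiv p (xi : R -> state R) t : params_ok p -> is_solution p xi ->
  0 <= t -> exists2 c, c <= 0 & hderiv t (fun s => energy p (xi s)) c.
Proof.
move=> ok [xiD [xid _]] t0; have xt := xiD t t0.
(* The sign condition fixes the value of the derivative; the rest shows that the energy has this
   derivative. *)
eexists; first exact: energy_rate_le0 ok xt.
have [r0 [a0 [e0 [i0 [l0 _]]]]] := ok.
have ra : 0 < rho p * Ar p by rewrite mulr_gt0.
have ei : 0 < E p * I p by rewrite mulr_gt0.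
have Hw s : 0 <= s -> _ := fun s0 => inX_Hk (xiD s s0).1.
have small eta : 0 < eta -> exists2 dl, 0 < dl & forall h, h != 0 -> `|h| < dl ->
    0 <= t + h -> let r := st_sub (st_scale h^-1 (st_sub (xi (t + h)) (xi t)))
                             (Fop p (xi t)) in
    [/\ L2norm2 (ell p) (v1 r) < eta, L2norm2 (ell p) (v2 r) < eta,
        L2norm2 (ell p) (der (ell p) 2 (w1 r) 2) < eta &
        L2norm2 (ell p) (der (ell p) 2 (w2 r) 2) < eta].
  move=> eta0; have [e1 e10 H1] := energy_small ok eta0.
  have [e2 e20 H2] := Xnorm_bound ok e10.
  have [dl dl0 Hdl] := xid t t0 _ e20.
  by exists dl => // h h0 hd th; apply: H1; apply: H2; exact: Hdl.
have [_ [[d1 [Hw1 _]] [[d2 [Hw2 _]] [[e1 [Hv1 _]] [e2 [Hv2 _]]]]]] := xt.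
have Lw1 := Hk_L2ae l0 Hw1; have Lw2 := Hk_L2ae l0 Hw2.
have Lv1 := Hk_L2ae l0 Hv1; have Lv2 := Hk_L2ae l0 Hv2.
have LD1 := der_L2ae l0 Hw1 (leqnn 4) (leqnn 4).
have LD2 := der_L2ae l0 Hw2 (leqnn 4) (leqnn 4).
have Lm : L2ae (ell p) (fun z => z + ell0 p) by exact/L2_L2ae/L2_shift.
(* Four terms follow, [v1], [v2] and the curvatures of [w1], [w2]. Each asks for square
   integrability along the trajectory, the same for the candidate derivative, and smallness of the
   error. *)
apply: hderivD; apply: hderivZ => //; apply: hderivD; apply: hderiv_ip => //.
- by move=> s /Hw[].
- rewrite /Fop/=.
  have -> : (fun z => - (E p * I p / (rho p * Ar p)) * der (ell p) 4 (w1 (xi t)) 4 z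
    + 2 * om3 (xi t) * v2 (xi t) z + nu2 p * (z + ell0 p) * gamma2 p (xi t)
    - nu3 p * w2 (xi t) z * gamma3 p (xi t)) =
    (fun z => (- (E p * I p / (rho p * Ar p)) * der (ell p) 4 (w1 (xi t)) 4 z
    + 2 * om3 (xi t) * v2 (xi t) z) + (nu2 p * gamma2 p (xi t) * (z + ell0 p)
    + - (nu3 p * gamma3 p (xi t)) * w2 (xi t) z)).
    by apply/funext => z; ring.
  by apply: L2aeD; apply: L2aeD; exact: L2aeZ.
- by move=> eps /small[dl dl0 H]; exists dl => // h h0 hd th; case: (H h h0 hd th).
- by move=> s /Hw[].
- rewrite /Fop/=.
  have -> : (fun z => - (E p * I p / (rho p * Ar p)) * der (ell p) 4 (w2 (xi t)) 4 z
    - 2 * om3 (xi t) * v1 (xi t) z - nu1 p * (z + ell0 p) * gamma1 p (xi t)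
    + nu3 p * w1 (xi t) z * gamma3 p (xi t)) =
    (fun z => (- (E p * I p / (rho p * Ar p)) * der (ell p) 4 (w2 (xi t)) 4 z
    + - (2 * om3 (xi t)) * v1 (xi t) z) + (- (nu1 p * gamma1 p (xi t)) * (z + ell0 p)
    + nu3 p * gamma3 p (xi t) * w1 (xi t) z)).
    by apply/funext => z; ring.
  by apply: L2aeD; apply: L2aeD; exact: L2aeZ.
- by move=> eps /small[dl dl0 H]; exists dl => // h h0 hd th; case: (H h h0 hd th).
- by move=> s /Hw[[d Hd] _ _ _]; exact: der_L2ae Hd _ _.
- exact: der_L2ae Hv1 _ _.
- move=> eps /small[dl dl0 H]; exists dl => // h h0 hd th.
  have [[d Hd] _ _ _] := Hw _ th; have [[d' Hd'] _ _ _] := Hw _ t0.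
  by rewrite -(der_diff_quot _ l0 Hd Hd' Hv1); case: (H h h0 hd th).
- by move=> s /Hw[_ [d Hd] _ _]; exact: der_L2ae Hd _ _.
- exact: der_L2ae Hv2 _ _.
- move=> eps /small[dl dl0 H]; exists dl => // h h0 hd th.
  have [_ [d Hd] _ _] := Hw _ th; have [_ [d' Hd'] _ _] := Hw _ t0.
  by rewrite -(der_diff_quot _ l0 Hd Hd' Hv2); case: (H h h0 hd th).
Qed.

Lemma yfun_small p (eps : R) : params_ok p -> 0 < eps ->
  exists2 delta, 0 < delta &
    forall x, inX p x -> energy p x < delta -> yfun p x < eps.
Proof.
move=> ok eps0; have [_ [_ [_ [_ [l0 _]]]]] := ok.
pose K := ell p ^+ 4 + ell p ^+ 2 + 1.
have K1 : 1 <= K.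
  by rewrite /K lerDr addr_ge0// exprn_ge0// ltW.
have K0 : 0 < K by lra.
have e4 : 0 < eps / 4 by lra.
have [delta delta0 H] := energy_small ok (divr_gt0 (exprn_gt0 2 e4) K0).
(* Here [a] is [K] for the H^2 norms and 1 for the velocity norms; as [a <= K], one threshold serves
   all four terms of [yfun]. *)
have lt_sqrt a b : 1 <= a -> a <= K -> 0 <= b -> b < (eps / 4) ^+ 2 / K ->
    Num.sqrt (a * b) < eps / 4.
  move=> a1 aK b0; rewrite ltr_pdivlMr// => bK.
  rewrite -[ltRHS](ger0_norm (ltW e4)) -sqrtr_sqr ltr_sqrt; last exact: exprn_gt0.
  by apply: le_lt_trans bK; rewrite mulrC ler_wpM2l.
exists delta => // x [c1 [c2 _]] /H[H1 H2 H3 H4].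
have y1 := le_lt_trans (H2norm_le l0 c1) (lt_sqrt _ _ K1 (lexx _) (L2norm2_ge0 _ _) H3).
have y2 := le_lt_trans (H2norm_le l0 c2) (lt_sqrt _ _ K1 (lexx _) (L2norm2_ge0 _ _) H4).
have := lt_sqrt _ _ (lexx 1) K1 (L2norm2_ge0 _ _) H1.
have := lt_sqrt _ _ (lexx 1) K1 (L2norm2_ge0 _ _) H2.
rewrite !mul1r /yfun /L2norm; lra.
Qed.

(** The equilibrium has zero elastic components, so a bound on the deviation from it bounds the
    energy of the state itself. *)
Lemma energy_sub_hat p x : energy p (st_sub x (xi_hat p)) = energy p x.
Proof.
rewrite /energy /st_sub /xi_hat /=.
have e (f : R -> R) : (fun z => f z + -1 * 0) = f.
  by apply/funext => z; rewrite mulr0 addr0.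
by rewrite !e.
Qed.

End energy.

Theorem theorem1 (R : realType) (p : params R) :
  params_ok p -> wellposed p ->
  forall eps : R, 0 < eps -> exists2 delta : R, 0 < delta &
    forall xi : R -> state R, is_solution p xi ->
      Xnorm p (st_sub (xi 0) (xi_hat p)) < delta ->
      forall t : R, 0 <= t -> yfun p (xi t) < eps.
Proof.
move=> ok _ eps eps0.
have [eta eta0 small_y] := yfun_small ok eps0.
have [delta delta0 small_energy] := Xnorm_bound ok eta0.
exists delta => // xi sol /small_energy; rewrite energy_sub_hat => e0 t t0.
apply: small_y; first by case: sol => /(_ t t0)[].
apply: le_lt_trans e0.
apply: (hderiv_le0 (q := fun s => energy p (xi s))) => // s s0.
exact: energy_hderiv ok sol s0.
Qed.
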